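(* The critical probability for bond percolation on the hyperbolic tiling $G(5)$ satisfies $$p_c(G(5))\le 0.299973 .$$
   Context: $G(5)$ is the infinite planar graph that is $5$-regular and tiles the (hyperbolic) plane by faces of length $5$. In bond percolation with parameter $p\in[0,1]$, each edge is independently open with probability $p$ and closed otherwise. For a fixed edge $e$ of $G(5)$, let $f(p)$ be the probability that $e$ belongs to an infinite connected component of the open subgraph (independent of $e$ by edge-transitivity). The critical probability $p_c(G(5))$ is the supremum of the set of $p$ with $f(p)=0$. *)

(* Defs.v *)
From Stdlib Require Import Relation_Operators.
From HB Require Import structures.
From mathcomp Require Import all_boot all_order all_algebra finmap.
From mathcomp Require Import all_classical all_reals all_analysis.

Set Implicit Arguments.
Unset Strict Implicit.
Unset Printing Implicit Defensive.

Import Order.TTheory GRing.Theory Num.Theory.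
Local Open Scope classical_set_scope.
Local Open Scope ring_scope.

(* A simple graph on V is a symmetric irreflexive relation [adj]; walks are
   sequences [u :: s] with [path adj u s]. A drawing of the graph on an oriented
   surface is given combinatorially by a rotation system: [rot v] sends each
   neighbour of v to the next one in the cyclic order around v. *)
Section Tilings.
Variables (V : choiceType) (adj : rel V) (rot : V -> V -> V).

Definition neighbours (v : V) : set V := [set u | adj v u].

Definition connected_graph : Prop :=
  forall u v : V, exists2 s, path adj u s & last u s = v.

Definition regular_graph (k : nat) : Prop :=
  forall v : V, (neighbours v #= `I_k)%card.

(* Transitivity forces [rot v] to permute the finite set of neighbours of v in a
   single cycle. *)
Definition rotation_system : Prop :=
  forall v u, adj v u ->
    adj v (rot v u) /\ forall w, adj v w -> exists i, iter i (rot v) u = w.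

(* The directed edge following (u, v) on the boundary of the face to which
   (u, v) belongs; the faces are the orbits of this map on directed edges. *)
Definition face_next (d : V * V) : V * V := (d.2, rot d.2 d.1).

Definition face_has_length (d : V * V) (m : nat) : Prop :=
  [/\ (0 < m)%N, iter m face_next d = d &
      forall i, (0 < i < m)%N -> iter i face_next d <> d].

(* The closed walk around the face containing (u, v), from u back to u. *)
Definition face_walk (u v : V) (m : nat) : seq V :=
  map fst (traject face_next (u, v) m.+1).

(* Elementary homotopies of walks in the surface made by gluing a disk to each
   face. *)
Inductive elementary_homotopy : seq V -> seq V -> Prop :=
| Backtrack s u v t : adj u v ->
    elementary_homotopy (s ++ [:: u; v; u] ++ t) (s ++ [:: u] ++ t)
| Face s u v m t : adj u v -> face_has_length (u, v) m ->
    elementary_homotopy (s ++ face_walk u v m ++ t) (s ++ [:: u] ++ t).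

Definition homotopic : seq V -> seq V -> Prop :=
  clos_refl_sym_trans (seq V) elementary_homotopy.

Definition simply_connected : Prop :=
  forall u s, path adj u s -> last u s = u -> homotopic (u :: s) [:: u].

End Tilings.

(* [adj] is the graph G(m): an infinite connected m-regular graph with an
   embedding all of whose faces have length m and which tiles the plane. The
   plane being the only simply connected surface without boundary that is not
   compact, the last condition says that gluing a disk to every face yields a
   simply connected surface. Without it, every infinite quotient of the tiling
   with the same local structure would qualify as well. *)
Definition regular_plane_tiling (m : nat) (V : choiceType) (adj : rel V) : Prop :=
  [/\ symmetric adj, irreflexive adj, infinite_set [set: V],
      connected_graph adj & regular_graph adj m] /\
  exists rot : V -> V -> V,
    [/\ rotation_system adj rot,
        forall u v, adj u v -> face_has_length rot (u, v) m &
        simply_connected adj rot].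

Definition edges (V : choiceType) (adj : rel V) : set {fset V} :=
  [set e | exists u v, adj u v /\ e = [fset u; v]%fset].

Section Percolation.
Context (R : realType) (V : choiceType) (adj : rel V).
Context (d : measure_display) (Omega : measurableType d).

(* Mutual independence of the events A i, i in I. *)
Definition independent_events (P : probability Omega R) (T : choiceType)
    (I : set T) (A : T -> set Omega) : Prop :=
  forall J : {fset T}, [set` J] `<=` I ->
    P (\bigcap_(i in [set` J]) A i) = (\prod_(i <- J) P (A i))%E.

(* [op e] is the event that the edge e is open. *)
Definition bond_percolation (p : R) (P : probability Omega R)
    (op : {fset V} -> set Omega) : Prop :=
  [/\ forall e, edges adj e -> measurable (op e),
      forall e, edges adj e -> P (op e) = p%:E &
      independent_events P (edges adj) op].

Variable op : {fset V} -> set Omega.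

Definition open_adj (w : Omega) : rel V :=
  [rel u v | adj u v && `[< op [fset u; v]%fset w >]].

(* The vertices connected to an endpoint of e by open edges. *)
Definition open_cluster (w : Omega) (e : {fset V}) : set V :=
  [set v | exists u s, [/\ u \in e, path (open_adj w) u s & last u s = v]].

Definition in_infinite_cluster (e : {fset V}) : set Omega :=
  [set w | op e w /\ infinite_set (open_cluster w e)].

End Percolation.

(* [P p] and [op p] describe the percolation of parameter p; the probability
   below is the f(p) of the edge e. *)
Definition critical_probability (R : realType) (V : choiceType) (adj : rel V)
    (d : measure_display) (Omega : measurableType d)
    (P : R -> probability Omega R) (op : R -> {fset V} -> set Omega)
    (e : {fset V}) : R :=
  sup [set p : R | 0 <= p <= 1 /\ P p (in_infinite_cluster adj (op p) e) = 0%E].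

(* Main.v *)
From Stdlib Require Import Relation_Operators.
Require Import Defs.
From HB Require Import structures.
From mathcomp Require Import all_boot all_order all_algebra finmap.
From mathcomp Require Import all_classical all_reals all_analysis.
From mathcomp Require Import zify ring lra.

(** Why the bound holds.  The tiling contains a tree whose branching number is
    2 + sqrt 2, and percolation on a tree survives with positive probability as
    soon as p times its branching number exceeds 1.  As 1 / (2 + sqrt 2) is
    about 0.2929, every p >= 0.299 percolates.

    The tree.  A non-backtracking walk that starts with a given dart is a word
    in the turns 1, 2, 3, 4: a walk that enters a vertex leaves it by the k-th
    edge, in the cyclic order, after the one by which it came.  Two such walks
    may meet again, for instance around a face.  The tree consists of the words
    without factor 1 2 ... 2 1 or 4 3 ... 3 4 (with any number of 2s or 3s,
    possibly none).  They are recognised by an automaton with three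
    states: the initial one allows all turns, each of the others all but one.
    The largest eigenvalue of its transition matrix is 2 + sqrt 2.

    The tree embeds ([vertex_inj]).  The group generated by an element rho of
    order 5 (rotation about a vertex) and an involution J (half-turn about the
    midpoint of an edge), with (J rho)^5 = 1, acts on the hyperbolic plane and
    preserves its tiling by pentagons.  Composing the elements of this group
    read along a walk of the graph defines a transport.  It is trivial around a
    backtrack and around a face, so simple connectedness makes it depend on the
    endpoints of the walk only ([transport_same_end]).  Hence words whose
    walks have the same endpoint yield the same point of the plane
    ([word_point_end]), and it remains to separate points, which is linear
    algebra over Q(sqrt 5): each state has a polyhedral cone ([region]) that
    the allowed turns map into one another ([region_turn]), and different turns
    lead into disjoint sectors ([sector_rotate]).

    The tree percolates ([reaches_ge]).  Distinct words have distinct last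
    edges, so that the subtrees hanging from a vertex depend on disjoint sets
    of edges and are independent ([independent_events_from], by Dynkin's
    pi-lambda theorem).  The probability to reach depth n then satisfies the
    recursion of a branching process with three types, and induction on n
    bounds it below by a positive constant ([survival_bound_step]).  Continuity
    from above gives an infinite cluster with positive probability
    ([infinite_cluster_gt0]), provided that this event is measurable, which
    comes from the countability of the graph
    ([measurable_in_infinite_cluster]). *)

Set Implicit Arguments.
Unset Strict Implicit.
Unset Printing Implicit Defensive.

Import Order.TTheory GRing.Theory Num.Theory.
Local Open Scope classical_set_scope.
Local Open Scope ring_scope.

(** * Rotations about a vertex *)

Lemma iter_modn (T : Type) (f : T -> T) (n k : nat) (x : T) :
  iter n f x = x -> iter (k %% n) f x = iter k f x.
Proof.
move=> fn; rewrite [in RHS](divn_eq k n) addnC iterD iterM.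
by rewrite [iter (k %/ n) _ x]iter_fix.
Qed.

Lemma iter_inj_period (T : Type) (f : T -> T) (n : nat) (x : T) :
  iter n f x = x -> (forall i, (0 < i < n)%N -> iter i f x <> x) ->
  {in `I_n &, injective (fun i => iter i f x)}.
Proof.
move=> fn small i j; rewrite !inE /=.
wlog lij : i j / (i <= j)%N.
  by move=> H ilt jlt ij; have [/H|/ltnW/H ->] := leqP i j => //; exact.
move=> ilt jlt ij; apply/eqP; rewrite eqn_leq lij leqNgt /=; apply/negP => iltj.
apply: (small (n - j + i)%N); last by rewrite iterD ij -iterD subnK // ltnW.
by move: jlt iltj; clear; lia.
Qed.

Section Rotation.
Variables (V : choiceType) (adj : rel V) (rot : V -> V -> V) (m : nat).
Hypothesis hreg : regular_graph adj m.
Hypothesis hrot : rotation_system adj rot.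

Lemma adj_iter_rot v u k : adj v u -> adj v (iter k (rot v) u).
Proof. by move=> vu; elim: k => //= k IH; case: (hrot IH). Qed.

(** The neighbours of [v] form a single cycle of [rot v], so its length is the
    degree. *)
Lemma rot_order v u : adj v u ->
  iter m (rot v) u = u /\ forall i, (0 < i < m)%N -> iter i (rot v) u <> u.
Proof.
move=> vu.
have exP : exists n, (0 < n)%N && `[< iter n (rot v) u = u >].
  have [_ /(_ u vu)[i iru]] := hrot (hrot vu).1.
  by exists i.+1; apply/andP; split=> //; apply/asboolP; rewrite iterSr.
case: (ex_minnP exP) => n /andP[n0 /asboolP nu] nmin.
have small i : (0 < i < n)%N -> iter i (rot v) u <> u.
  case/andP=> i0 iltn iu; have := nmin i; rewrite i0 /= => /(_ (asboolT iu)).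
  by rewrite leqNgt iltn.
suff -> : m = n by [].
apply/card_eq_II; apply: card_eq_trans (_ : `I_m #= neighbours adj v)%card _.
  by rewrite card_eq_sym.
have -> : neighbours adj v = (fun i => iter i (rot v) u) @` `I_n.
  apply/seteqP; split => [w /= vw|_ [i _ <-]]; last exact: adj_iter_rot.
  have [_ /(_ w vw)[i iw]] := hrot vu.
  by exists (i %% n)%N; [exact: ltn_pmod|rewrite iter_modn].
exact/inj_card_eq/iter_inj_period.
Qed.

Lemma iter_rot_modn v u i j : adj v u ->
  iter i (rot v) u = iter j (rot v) u -> i = j %[mod m].
Proof.
move=> vu; have [um small] := rot_order vu.
have m0 : (0 < m)%N.
  rewrite lt0n; apply/eqP => m0; have := hreg v.
  rewrite m0 II0 card_eq0 => /eqP N0.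
  by have : neighbours adj v u by []; rewrite N0.
rewrite -(iter_modn i um) -(iter_modn j um).
by move/(iter_inj_period um small); apply; rewrite inE; exact: ltn_pmod.
Qed.

(** An arbitrary origin for counting the edges around each vertex. *)
Definition base_neighbour (v : V) : V := xget v (neighbours adj v).

Definition rot_index (v u : V) : nat :=
  xget 0%N [set i | iter i (rot v) (base_neighbour v) = u].

Lemma adj_base v u : adj v u -> adj v (base_neighbour v).
Proof. by move=> vu; apply: (xgetPex v (P := neighbours adj v)); exists u. Qed.

Lemma rot_indexP v u : adj v u ->
  iter (rot_index v u) (rot v) (base_neighbour v) = u.
Proof.
move=> vu; have [_ /(_ u vu) ex] := hrot (adj_base vu).
exact: (xgetPex 0%N ex).
Qed.

Lemma rot_index_iter v u k : adj v u ->
  rot_index v (iter k (rot v) u) = (k + rot_index v u)%N %[mod m].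
Proof.
move=> vu; apply: (@iter_rot_modn v (base_neighbour v)); first exact: adj_base vu.
rewrite rot_indexP; last exact: adj_iter_rot.
by rewrite iterD rot_indexP.
Qed.

End Rotation.

(** * Transport along walks *)

Section Transport.
Variables (V : choiceType) (adj : rel V) (rot : V -> V -> V) (m : nat).
Hypothesis sym : symmetric adj.
Hypothesis hreg : regular_graph adj m.
Hypothesis hrot : rotation_system adj rot.
Hypothesis hface : forall u v, adj u v -> face_has_length rot (u, v) m.
Hypothesis hsc : simply_connected adj rot.

Variables (T : Type) (rho J : T -> T).
Hypothesis rhom : forall x, iter m rho x = x.
Hypothesis JJ : involutive J.
Hypothesis Jrhom : forall x, iter m (J \o rho) x = x.

Local Notation idx := (rot_index adj rot).

Lemma iter_rho_mod i j x : i = j %[mod m] -> iter i rho x = iter j rho x.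
Proof. by move=> ij; rewrite -(iter_modn i (rhom x)) ij iter_modn. Qed.

Lemma iter_rhoK i j x : (m %| i + j)%N -> iter i rho (iter j rho x) = x.
Proof. by move=> /eqP mij; rewrite -iterD -(iter_modn _ (rhom x)) mij. Qed.

(** The frame at [u] has its first axis towards [base_neighbour u]; this is the
    change of frame from [v] to [u]: rotate the axis at [v] onto the edge, cross
    the edge, rotate onto the axis at [u].  The exponent [m.-1 * i] stands for
    [- i]. *)
Definition edge_transport (u v : V) (x : T) : T :=
  iter (idx u v) rho (J (iter (m.-1 * idx v u) rho x)).

Fixpoint transport_from (u : V) (s : seq V) (x : T) : T :=
  if s is v :: s' then edge_transport u v (transport_from v s' x) else x.

Definition transport (s : seq V) : T -> T :=
  if s is u :: s' then transport_from u s' else id.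

Lemma transport_from_cat u s t x :
  transport_from u (s ++ t) x =
  transport_from u s (transport_from (last u s) t x).
Proof. by elim: s u => //= v s IH u; rewrite IH. Qed.

Lemma transport_catl s u t x :
  transport (s ++ u :: t) x = transport (rcons s u) (transport_from u t x).
Proof.
case: s => [|v s] //=; rewrite -cat_rcons transport_from_cat.
by rewrite last_rcons.
Qed.

Lemma m_gt0 u v : adj u v -> (0 < m)%N.
Proof. by move=> /hface[]. Qed.

Lemma edge_transportK u v x : adj u v ->
  edge_transport u v (edge_transport v u x) = x.
Proof.
move=> uv; have m0 := m_gt0 uv; rewrite /edge_transport.
rewrite [iter (m.-1 * idx v u) rho _]iter_rhoK; last first.
  by rewrite -mulSnr prednK // dvdn_mulr.
by rewrite JJ iter_rhoK // -mulSn prednK // dvdn_mulr.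
Qed.

(** Entering [v] from [u] and turning by [k] edges is [J] followed by the [k]-th
    power of [rho] in the frames attached to the darts, where the choice of the
    base neighbours cancels out. *)
Lemma edge_transport_turn u v k x : adj u v ->
  edge_transport u v (iter (idx v (iter k (rot v) u)) rho x) =
  iter (idx u v) rho (J (iter k rho x)).
Proof.
move=> uv; have m0 := m_gt0 uv; have vu : adj v u by rewrite sym.
rewrite /edge_transport; congr (iter _ rho (J _)).
have /iter_rho_mod -> := rot_index_iter hreg hrot k vu.
by rewrite addnC iterD iter_rhoK // -mulSnr prednK // dvdn_mulr.
Qed.

(** Around a face every turn is by one edge, so that each corner contributes a
    factor [J \o rho]. *)
Lemma transport_face_prefix u v n x : adj u v ->
  transport (map fst (traject (face_next rot) (u, v) n.+1))
    (iter (idx (iter n (face_next rot) (u, v)).1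
               (iter n (face_next rot) (u, v)).2) rho x) =
  iter (idx u v) rho (iter n (J \o rho) x).
Proof.
elim: n u v x => [//|n IH] u v x uv.
have vr : adj v (rot v u) by have [] := hrot (_ : adj v u) => //; rewrite sym.
have IHn := IH v (rot v u) x vr.
have uvE : face_next rot (u, v) = (v, rot v u) by [].
rewrite iterSr /= uvE /= [transport_from v _ _]IHn.
exact: (@edge_transport_turn u v 1).
Qed.

(** A backtrack gives an edge and its inverse, a face gives a conjugate of the
    [m]-th power of [J \o rho]. *)
Lemma transport_homotopy s t : elementary_homotopy adj rot s t ->
  forall x, transport s x = transport t x.
Proof.
case=> [{}s u v {}t uv|{}s u v n {}t uv fn] x.
  rewrite !transport_catl /=; congr (transport _ _).
  by rewrite edge_transportK.
suff mn : m = n.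
  rewrite -{}mn /face_walk /= !transport_catl.
  congr (transport _ _); rewrite transport_from_cat.
  have [_ /(congr1 fst) /= mu _] := hface uv.
  have -> : last u (map fst (traject (face_next rot) (face_next rot (u, v)) m)) = u.
    by rewrite (last_map fst _ (u, v)) last_traject mu.
  set y := transport_from u t x.
  have [_ mu' _] := hface uv.
  have := @transport_face_prefix u v m (iter (m.-1 * idx u v) rho y) uv.
  rewrite /= mu' /= Jrhom iter_rhoK //.
  by rewrite -mulSn prednK ?dvdn_mulr // (m_gt0 uv).
have [m0 mu mmin] := hface uv; have [n0 nu nmin] := fn.
case: (ltngtP m n) => // [mn|nm].
- by case: (nmin m); rewrite ?m0.
- by case: (mmin n); rewrite ?n0.
Qed.

Lemma transport_closed u s x : path adj u s -> last u s = u ->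
  transport_from u s x = x.
Proof.
move=> us /(hsc us) ht; rewrite -[LHS]/(transport (u :: s) x).
rewrite -[RHS]/(transport [:: u] x).
elim: ht => {us s u}[s t|//|s t _ ->//|s t r _ -> _ ->//].
by move/transport_homotopy ->.
Qed.

Lemma walk_rev u s : path adj u s ->
  exists2 t, path adj (last u s) t & last (last u s) t = u.
Proof.
elim: s u => [|v s IH] u /=; first by exists [::].
case/andP=> uv /IH[t vt tv]; exists (rcons t u); last by rewrite last_rcons.
by rewrite rcons_path vt tv sym.
Qed.

(** Both walks are closed by the same way back. *)
Lemma transport_same_end u s t x : path adj u s -> path adj u t ->
  last u s = last u t -> transport_from u s x = transport_from u t x.
Proof.
move=> us ut st; have [r sr ru] := walk_rev us.
have sKt y : transport_from u t (transport_from (last u s) r y) = y.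
  rewrite st -transport_from_cat; apply: transport_closed.
    by rewrite cat_path ut -st.
  by rewrite last_cat -st.
have rKs : transport_from (last u s) r (transport_from u s x) = x.
  rewrite -[in X in transport_from _ _ X]ru -transport_from_cat.
  apply: transport_closed; first by rewrite cat_path sr ru.
  by rewrite last_cat ru.
by rewrite -{2}rKs sKt.
Qed.

End Transport.

(** * Words of turns *)

Section Words.
Variables (V : choiceType) (adj : rel V) (rot : V -> V -> V).

Definition turn (d : V * V) (k : nat) : V * V := (d.2, iter k (rot d.2) d.1).

Definition follow (d : V * V) (w : seq nat) : V * V := foldl turn d w.

Fixpoint word_walk (d : V * V) (w : seq nat) : seq V :=
  if w is k :: w' then (turn d k).2 :: word_walk (turn d k) w' else [::].

Lemma last_word_walk d w : last d.2 (word_walk d w) = (follow d w).2.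
Proof. by elim: w d => //= k w IH d; rewrite -IH. Qed.

Hypothesis sym : symmetric adj.
Hypothesis hrot : rotation_system adj rot.

Lemma adj_turn d k : adj d.1 d.2 -> adj (turn d k).1 (turn d k).2.
Proof. by move=> dd; apply: (adj_iter_rot hrot); rewrite sym. Qed.

Lemma adj_follow d w : adj d.1 d.2 -> adj (follow d w).1 (follow d w).2.
Proof. by elim: w d => //= k w IH d dd; apply/IH/adj_turn. Qed.

Lemma path_word_walk d w : adj d.1 d.2 -> path adj d.2 (word_walk d w).
Proof.
by elim: w d => //= k w IH d dd; rewrite (adj_turn k dd) (IH _ (adj_turn k dd)).
Qed.

Variable m : nat.
Hypothesis hreg : regular_graph adj m.
Hypothesis hface : forall u v, adj u v -> face_has_length rot (u, v) m.
Hypothesis hsc : simply_connected adj rot.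
Variables (T : Type) (rho J : T -> T) (x0 : T).
Hypothesis rhom : forall x, iter m rho x = x.
Hypothesis JJ : involutive J.
Hypothesis Jrhom : forall x, iter m (J \o rho) x = x.
Hypothesis rho_x0 : rho x0 = x0.

(** The endpoint of the walk of a word, in the frame of the initial dart: [x0] is
    the tail of that dart and [J x0] its head. *)
Fixpoint word_point (w : seq nat) : T :=
  J (if w is k :: w' then iter k rho (word_point w') else x0).

Lemma transport_word d w : adj d.1 d.2 ->
  transport_from adj rot m rho J d.1 (d.2 :: word_walk d w) x0 =
  iter (rot_index adj rot d.1 d.2) rho (word_point w).
Proof.
elim: w d => [|k w IH] d dd /=.
  by rewrite /edge_transport [iter (m.-1 * _) rho x0]iter_fix.
have /= := IH _ (adj_turn k dd); rewrite /= => ->.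
exact: (edge_transport_turn sym hreg hrot hface).
Qed.

(** Both walks start with the dart [d], and the transport sees only their
    common endpoint. *)
Lemma word_point_end d w w' : adj d.1 d.2 ->
  (follow d w).2 = (follow d w').2 -> word_point w = word_point w'.
Proof.
move=> dd ww.
have := @transport_same_end _ _ _ _ sym hreg hrot hface hsc _ _ _ rhom JJ Jrhom
  d.1 (d.2 :: word_walk d w) (d.2 :: word_walk d w') x0.
rewrite !transport_word //= dd !path_word_walk // !last_word_walk.
move=> /(_ isT isT ww) /(congr1 (iter (m.-1 * rot_index adj rot d.1 d.2) rho)).
have m0 : (0 < m)%N by have [] := hface dd.
by rewrite !(iter_rhoK rhom) // -mulSnr prednK // dvdn_mulr.
Qed.

Lemma word_point_start d w : adj d.1 d.2 ->
  (follow d w).2 = d.1 -> word_point w = x0.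
Proof.
move=> dd wd.
have := @transport_closed _ _ _ _ sym hreg hrot hface hsc _ _ _ rhom JJ Jrhom
  d.1 (d.2 :: word_walk d w) x0.
rewrite transport_word //= dd path_word_walk // last_word_walk.
move=> /(_ isT wd) /(congr1 (iter (m.-1 * rot_index adj rot d.1 d.2) rho)).
have m0 : (0 < m)%N by have [] := hface dd.
rewrite (iter_rhoK rhom); last by rewrite -mulSnr prednK // dvdn_mulr.
by rewrite [iter (m.-1 * _) rho x0]iter_fix.
Qed.

End Words.

(** * An automaton for the tree *)

Section Language.

(** [s.1] allows the turn 1 and [s.2] allows the turn 4. *)
Definition state := (bool * bool)%type.

Definition turns (s : state) : seq nat :=
  (if s.1 then [:: 1] else [::])%N ++ [:: 2; 3]%N ++
  (if s.2 then [:: 4] else [::])%N.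

(** After a turn 1, the turn 1 stays forbidden as long as the walk turns by 2:
    a walk 1 2 ... 2 1 runs along a strip of faces, on the other side of which
    another walk may reach its end.  Turns 4 and 3 are the mirror image. *)
Definition next_state (s : state) (k : nat) : state :=
  match k with
  | 1 => (false, true) | 2 => (s.1, true) | 3 => (true, s.2) | _ => (true, false)
  end%N.

Lemma mem_turns s k : k \in turns s -> k \in [:: 1; 2; 3; 4]%N.
Proof. by case: s k => [[] []] [|[|[|[|[|k]]]]]. Qed.

Fixpoint accepted (s : state) (w : seq nat) : bool :=
  if w is k :: w' then (k \in turns s) && accepted (next_state s k) w' else true.

Lemma accepted_cat s w w' :
  accepted s (w ++ w') = accepted s w && accepted (foldl next_state s w) w'.
Proof. by elim: w s => //= k w IH s; rewrite IH andbA. Qed.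

End Language.

(** * The tiling in the hyperbolic plane *)

Section Geometry.
Variable R : realType.

Definition phi : R := (1 + Num.sqrt 5%:R) / 2%:R.

Lemma phi_sqr : phi * phi = phi + 1.
Proof.
have : Num.sqrt (5%:R : R) ^+ 2 = 5%:R by rewrite sqr_sqrtr // ler0n.
rewrite /phi expr2; set t := Num.sqrt _; move=> tt.
have -> : (1 + t) / 2%:R * ((1 + t) / 2%:R) = (1 + 2 * t + t * t) / 4%:R by field.
by rewrite tt; field.
Qed.

Lemma phi_bounds : 16 / 10 < phi < 162 / 100.
Proof.
have := phi_sqr; have : 0 < phi.
  by rewrite /phi divr_gt0 // ltr_pwDl ?sqrtr_ge0 // ltr01.
by move=> h e; apply/andP; split; nra.
Qed.

(** The Coxeter group [5,5] has generators s0, s1, s2, where s0 s1 and s1 s2 have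
    order 5 and s0 s2 has order 2.  It acts on the dual of the space spanned by
    its simple roots alpha0, alpha1, alpha2.  A point x of this dual is given by
    its values on alpha0, on alpha1 and on s2 alpha1 = alpha1 + phi alpha2.  In
    these coordinates [rho] is s1 s2, [flip] is s0 s2, and [origin] is the point
    fixed by s1 and s2, which represents a vertex of the tiling. *)
Definition vector3 := (R * R * R)%type.
Definition rho (x : vector3) : vector3 :=
  (x.1.1 + phi * x.2, - x.2, x.1.2 + (phi - 1) * x.2).
Definition flip (x : vector3) : vector3 :=
  (- x.1.1, x.2 + phi * x.1.1, x.1.2 + phi * x.1.1).

Definition origin : vector3 := (1, 0, 0).

Lemma rho_origin : rho origin = origin.
Proof. by rewrite /rho /origin /=; congr (_, _, _); ring. Qed.

Lemma flipK : involutive flip.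
Proof. by case=> [[a x] y]; rewrite /flip /=; congr (_, _, _); ring. Qed.

Lemma rho5 x : iter 5 rho x = x.
Proof.
by case: x => [[a x] y]; rewrite /rho /=; congr (_, _, _); ring: phi_sqr.
Qed.

Lemma flip_rho5 x : iter 5 (flip \o rho) x = x.
Proof.
by case: x => [[a x] y]; rewrite /rho /flip /=; congr (_, _, _); ring: phi_sqr.
Qed.

(** The mirrors of alpha1 and s2 alpha1 bound the sector of angle 2 pi / 5 at
    [origin] whose axis is the edge towards [flip origin]. *)
Definition sector (x : vector3) : bool := (0 < x.1.2) && (0 < x.2).

(** A cone containing the points of the words accepted from the state [s].  The
    first two conditions are those of [sector].  When [s.1] is false, the turns
    so far end with 1 2 ... 2; the fourth condition is the one that keeps the
    walk, at this turn 1, in the sector of the previous vertex (the third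
    coordinate in [flip_rho1]), and turns 2 preserve it.  The fifth is its
    mirror image, for turns 4 and 3.  The third condition is the sum of these
    two without their premises: a linear substitute for the light cone, which
    makes the family of cones invariant. *)
Definition region (s : state) (x : vector3) : bool :=
  [&& 0 < x.1.2, 0 < x.2, 0 < 2 * x.1.1 + x.1.2 + x.2,
      s.1 || (0 < x.1.1 + x.2) & s.2 || (0 < x.1.1 + x.1.2)].

(** The five sectors at a vertex are disjoint. *)
Lemma sector_rotate k x : (k < 4)%N -> sector x -> sector (iter k.+1 rho x) = false.
Proof.
case: x => [[a x] y]; rewrite /sector /= => k4 /andP[x0 y0].
have [b1 b2] := andP phi_bounds.
have xb : 0 < (phi - 1) * x by apply: mulr_gt0 => //; lra.
have yb : 0 < (phi - 1) * y by apply: mulr_gt0 => //; lra.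
apply/negbTE; case: k k4 => [|[|[|[|//]]]] _; rewrite /rho /= negb_and -!leNgt.
- by apply/orP; left; lra.
- by apply/orP; left; lra.
- apply/orP; right; apply: le_trans (_ : (1 - phi) * x - y <= 0); last by lra.
  by rewrite le_eqVlt; apply/orP; left; apply/eqP; ring: phi_sqr.
- apply/orP; right; apply: le_trans (_ : - x <= 0); last by lra.
  by rewrite le_eqVlt; apply/orP; left; apply/eqP; ring: phi_sqr.
Qed.

Lemma flip_rho1 a x y : flip (iter 1 rho (a, x, y)) =
  (- a - phi * y, phi * a + x + 2 * (phi * y), phi * a + phi * y).
Proof. by rewrite /flip /rho /=; congr (_, _, _); ring: phi_sqr. Qed.

Lemma flip_rho2 a x y : flip (iter 2 rho (a, x, y)) =
  (- a - phi * x - y - phi * y, phi * a + 2 * (phi * x) + 2 * y + phi * y,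
   phi * a + phi * x + 2 * y + phi * y).
Proof. by rewrite /flip /rho /=; congr (_, _, _); ring: phi_sqr. Qed.

Lemma flip_rho3 a x y : flip (iter 3 rho (a, x, y)) =
  (- a - x - phi * x - phi * y, phi * a + 2 * x + phi * x + phi * y,
   phi * a + 2 * x + phi * x + 2 * (phi * y)).
Proof. by rewrite /flip /rho /=; congr (_, _, _); ring: phi_sqr. Qed.

Lemma flip_rho4 a x y : flip (iter 4 rho (a, x, y)) =
  (- a - phi * x, phi * a + phi * x, phi * a + 2 * (phi * x) + y).
Proof. by rewrite /flip /rho /=; congr (_, _, _); ring: phi_sqr. Qed.

Lemma region_flip_origin s : region s (flip origin).
Proof.
have [b1 b2] := andP phi_bounds.
by case: s => l r; rewrite /region /flip /origin /= -!(rwP andP); repeat split;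
   try (apply/orP; right); lra.
Qed.

(** Each inequality defining the target cone is a combination of those of the
    source with nonnegative coefficients in Q(phi).  Multiplying the latter by
    [phi - 16 / 10] and [162 / 100 - phi] lets linear arithmetic over Q find
    it. *)
Lemma region_turn s k x : k \in turns s -> region (next_state s k) x ->
  region s (flip (iter k rho x)).
Proof.
case: s x => l r [[a x] y].
have [b1 b2] := andP phi_bounds.
have pos z : 0 < z -> 0 < (phi - 16 / 10) * z /\ 0 < (162 / 100 - phi) * z.
  by move=> z0; split; apply: mulr_gt0 => //; lra.
move=> kin /and5P[x0 y0 t0 hA hB]; rewrite /= in x0 y0 t0 hA hB.
have [x1 x2] := pos _ x0; have [y1 y2] := pos _ y0; have [t1 t2] := pos _ t0.
have {}hA : ~~ (next_state (l, r) k).1 -> [/\ 0 < a + y,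
    0 < (phi - 16 / 10) * (a + y) & 0 < (162 / 100 - phi) * (a + y)].
  by move=> /negbTE nl; move: hA; rewrite nl => h; case: (pos _ h).
have {}hB : ~~ (next_state (l, r) k).2 -> [/\ 0 < a + x,
    0 < (phi - 16 / 10) * (a + x) & 0 < (162 / 100 - phi) * (a + x)].
  by move=> /negbTE nl; move: hB; rewrite nl => h; case: (pos _ h).
have := mem_turns kin.
rewrite !inE => /or4P[] /eqP kE; subst k.
- rewrite flip_rho1 /=; have [//|h h1 h2] := hA.
  apply/and5P; split => /=; [lra|lra|lra| |apply/orP; right; lra].
  by move: kin; case: (l) (r) => [] [].
- rewrite flip_rho2 /=.
  apply/and5P; split => /=; [lra|lra|lra| |apply/orP; right; lra].
  case: (l) hA => //= hA; have [h h1 h2] := hA isT.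
  lra.
- rewrite flip_rho3 /=.
  apply/and5P; split => /=; [lra|lra|lra|apply/orP; right; lra|].
  case: (r) hB => //= hB; have [h h1 h2] := hB isT.
  lra.
- rewrite flip_rho4 /=; have [//|h h1 h2] := hB.
  apply/and5P; split => /=; [lra|lra|lra|apply/orP; right; lra|].
  by move: kin; case: (l) (r) => [] [].
Qed.

End Geometry.

(** * Distinct words have distinct endpoints *)

Section WordPoints.
Variable R : realType.

Local Notation rho := (@rho R).
Local Notation flip := (@flip R).
Local Notation origin := (@origin R).
Local Notation pt := (word_point rho flip origin).

Lemma iter_rho_inj k : injective (iter k rho).
Proof.
by apply: (can_inj (g := iter (4 * k) rho)) => x; apply: (iter_rhoK (@rho5 R)); lia.
Qed.

Lemma region_sector s (x : vector3 R) : region s x -> sector x.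
Proof. by rewrite /sector => /and5P[-> ->]. Qed.

Lemma region_word_point s w : accepted s w -> region s (pt w).
Proof.
elim: w s => [|k w IH] s /=; first by move=> _; exact: region_flip_origin.
by case/andP=> ks /IH; apply: region_turn.
Qed.

Lemma word_point_neq_origin s w : accepted s w -> pt w <> origin.
Proof.
move=> /region_word_point/region_sector; rewrite /sector => /andP[+ _] pw.
by rewrite pw /= ltxx.
Qed.

(** The point of a word lies, up to a rotation by the first turn, in the open
    base sector, so it determines this turn, which can be undone. *)
Lemma word_point_inj s w w' :
  accepted s w -> accepted s w' -> pt w = pt w' -> w = w'.
Proof.
have nil_cons s' k v : accepted s' (k :: v) -> pt [::] <> pt (k :: v).
  rewrite /= => /andP[_ /word_point_neq_origin nv] /(can_inj (@flipK R)).
  rewrite -[LHS](iter_fix k (rho_origin R)) => /iter_rho_inj nv'.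
  exact: nv.
elim: w w' s => [|k w IH] [|k' w'] s // aw aw' ww.
- by case: (nil_cons _ _ _ aw' ww).
- by case: (nil_cons _ _ _ aw (esym ww)).
have kk' : k = k'.
  move: aw aw' ww; rewrite /= => /andP[ks aw] /andP[k's aw'].
  move/(can_inj (@flipK R)).
  have wS := region_sector (region_word_point aw).
  have wS' := region_sector (region_word_point aw').
  move: wS wS' (mem_turns ks) (mem_turns k's).
  move: (pt w) (pt w') => p p' {aw aw' ks k's IH}.
  wlog kk' : k k' p p' / (k <= k')%N.
    move=> H; case: (leqP k k') => [|/ltnW] h; first exact: (H k k' p p').
    by move=> *; apply/esym/(H k' k p' p).
  move=> pS pS' k4 k4' pp'; apply/eqP; rewrite eqn_leq kk' leqNgt /=.
  apply/negP => ltk.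
  have /iter_rho_inj pE : iter k rho p = iter k rho (iter (k' - k) rho p').
    by rewrite -iterD subnKC.
  have k'k : (k' - k = (k' - k).-1.+1)%N by rewrite prednK // subn_gt0.
  suff : sector (iter (k' - k).-1.+1 rho p') = false.
    by rewrite -k'k -pE pS.
  by apply: sector_rotate => //; move: k4 k4'; rewrite !inE; clear; lia.
subst k'; congr (_ :: _).
move: aw aw' ww; rewrite /= => /andP[_ aw] /andP[_ aw'].
by move/(can_inj (@flipK R))/iter_rho_inj; apply: (IH _ _ aw aw').
Qed.

End WordPoints.

Section Tree.
Variables (V : choiceType) (adj : rel V) (rot : V -> V -> V).
Hypothesis sym : symmetric adj.
Hypothesis hreg : regular_graph adj 5.
Hypothesis hrot : rotation_system adj rot.
Hypothesis hface : forall u v, adj u v -> face_has_length rot (u, v) 5.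
Hypothesis hsc : simply_connected adj rot.
Variables (R : realType) (d : V * V).
Hypothesis dadj : adj d.1 d.2.

Lemma vertex_inj s w w' : accepted s w -> accepted s w' ->
  (follow rot d w).2 = (follow rot d w').2 -> w = w'.
Proof.
move=> aw aw' ww; apply: (@word_point_inj R s) => //.
exact: (word_point_end sym hrot hreg hface hsc (@rho5 R) (@flipK R)
  (@flip_rho5 R) (@rho_origin R) dadj ww).
Qed.

Lemma vertex_neq_start s w : accepted s w -> (follow rot d w).2 <> d.1.
Proof.
move=> aw wd; apply: (@word_point_neq_origin R _ _ aw).
exact: (word_point_start sym hrot hreg hface hsc (@rho5 R) (@flipK R)
  (@flip_rho5 R) (@rho_origin R) dadj wd).
Qed.

(** The edges of the tree are indexed by words; the empty word gives the edge of
    the initial dart. *)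
Definition last_edge (w : seq nat) : {fset V} :=
  [fset (follow rot d w).1; (follow rot d w).2]%fset.

Lemma follow_rcons w k : follow rot d (rcons w k) = turn rot (follow rot d w) k.
Proof. by rewrite /follow foldl_rcons. Qed.

Lemma last_edge_edges w : edges adj (last_edge w).
Proof.
by exists (follow rot d w).1, (follow rot d w).2; split=> //; exact: adj_follow.
Qed.

(** An edge of the tree crossed in both directions would make each of the two
    words a proper prefix of the other. *)
Lemma last_edge_inj s w w' : accepted s w -> accepted s w' ->
  last_edge w = last_edge w' -> w = w'.
Proof.
move=> aw aw' ww.
have: (follow rot d w).2 \in last_edge w' by rewrite -ww !inE eqxx orbT.
have: (follow rot d w').2 \in last_edge w by rewrite ww !inE eqxx orbT.
rewrite !inE => /orP[|] /eqP e1 /orP[|] /eqP e2; try exact: (@vertex_inj s).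
  case/lastP: w aw {ww} e1 e2 => [|w k] aw e1 e2.
    by case: (vertex_neq_start aw' e1).
  case/lastP: w' aw' e1 e2 => [|w' k'] aw' e1 e2.
    by case: (vertex_neq_start aw e2).
  have pre v j : accepted s (rcons v j) -> accepted s v.
    by rewrite -cats1 accepted_cat => /andP[].
  rewrite [in RHS]follow_rcons in e1; rewrite [in RHS]follow_rcons in e2.
  have /(congr1 size) := vertex_inj aw' (pre _ _ aw) e1.
  have /(congr1 size) := vertex_inj aw (pre _ _ aw') e2.
  by rewrite !size_rcons; lia.
Qed.

End Tree.

(** * Independence of events depending on disjoint sets of edges *)

Section Independence.
Context (R : realType) (d : measure_display) (Omega : measurableType d).
Variable P : probability Omega R.

Lemma fin_num_probability X : measurable X -> P X \is a fin_num.
Proof. by move=> mX; exact: fin_num_measure. Qed.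

Lemma independent_of_dynkin (B : set Omega) : measurable B ->
  dynkin [set X | measurable X /\ P (X `&` B) = (P X * P B)%E].
Proof.
move=> mB; split => /=.
- by rewrite setTI probability_setT mul1e.
- move=> X [mX XB]; split; first exact: measurableC.
  have -> : P (~` X `&` B) = (P B - P (X `&` B))%E.
    rewrite [in LHS]setIC -setDE measureD //.
      by rewrite [B `&` _]setIC.
    by rewrite ltey_eq fin_num_probability.
  have [x xE] : exists x, P X = x%:E.
    by exists (fine (P X)); rewrite fineK // fin_num_probability.
  have [b bE] : exists b, P B = b%:E.
    by exists (fine (P B)); rewrite fineK // fin_num_probability.
  rewrite XB probability_setC // xE bE.
  have e : (b - x * b)%:E = ((1 - x) * b)%:E by congr EFin; ring.
  exact: e.
- move=> F tF mF.
  have mF' n : measurable (F n) by case: (mF n).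
  split; first exact: bigcupT_measurable.
  rewrite setI_bigcupl !measure_bigcup //; last 2 first.
  - by move=> n _; exact: measurableI.
  - by apply/trivIset_setIr.
  have -> : P B = (fine (P B))%:E by rewrite fineK // fin_num_probability.
  rewrite muleC -nneseriesZl //.
  apply: eq_eseriesr => n _; transitivity (P (F n) * P B)%E.
    by case: (mF n).
  by rewrite muleC fineK // fin_num_probability.
Qed.

(** Dynkin's pi-lambda theorem, for the lambda-system above. *)
Lemma independent_of_sigma_algebra (G : set (set Omega)) (B : set Omega) :
  setI_closed G -> measurable B ->
  (forall X, G X -> measurable X /\ P (X `&` B) = (P X * P B)%E) ->
  forall X, <<s G >> X -> measurable X /\ P (X `&` B) = (P X * P B)%E.
Proof.
move=> GI mB GB; rewrite -setI_closed_g_dynkin_g_sigma_algebra //.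
exact: (smallest_sub (independent_of_dynkin mB)).
Qed.

Variables (T : choiceType) (I : set T) (A : T -> set Omega).
Hypothesis mA : forall i, I i -> measurable (A i).
Hypothesis indA : independent_events P I A.

Definition finite_intersections (J : set T) : set (set Omega) :=
  [set X | exists2 L : {fset T}, [set` L] `<=` J &
     X = \bigcap_(i in [set` L]) A i].

(** The events that depend only on the [A i] with [i] in [J]. *)
Definition events_from (J : set T) : set (set Omega) :=
  <<s finite_intersections J >>.

Lemma setI_closed_finite_intersections J : setI_closed (finite_intersections J).
Proof.
move=> _ _ [L LJ ->] [M MJ ->]; exists (L `|` M)%fset.
  by move=> i /=; rewrite inE => /orP[/LJ|/MJ].
rewrite -bigcap_setU; congr bigcap.
by apply/seteqP; split => i /=; rewrite inE => /orP.
Qed.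

Lemma measurable_finite_intersection J X : J `<=` I ->
  finite_intersections J X -> measurable X.
Proof.
move=> JI [L LJ ->]; apply: fin_bigcap_measurable => // i /LJ/JI; exact: mA.
Qed.

Lemma independent_finite_intersections J K X Y : J `<=` I -> K `<=` I ->
  J `&` K = set0 -> finite_intersections J X -> finite_intersections K Y ->
  P (X `&` Y) = (P X * P Y)%E.
Proof.
move=> JI KI JK0 [L LJ ->] [M MK ->].
have LM i : i \in L -> i \in M -> False.
  by move=> /LJ Ji /MK Ki; suff: (J `&` K) i by rewrite JK0.
have LUM : [set` (L `|` M)%fset] = [set` L] `|` [set` M].
  by apply/seteqP; split => i /=; rewrite inE => /orP.
have LI := subset_trans LJ JI; have MI := subset_trans MK KI.
have LMI : [set` (L `|` M)%fset] `<=` I by rewrite LUM subUset.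
rewrite -bigcap_setU -LUM !indA //.
rewrite -big_cat; apply: perm_big; apply: uniq_perm => //.
- rewrite cat_uniq !fset_uniq /= andbT; apply/hasPn => i iM.
  by apply/negP => /LM; apply.
- by move=> i; rewrite mem_cat inE.
Qed.

(** The pi-lambda theorem is applied twice, to extend independence from the
    finite intersections first on the left, then on the right. *)
Lemma independent_events_from J K X Y : J `<=` I -> K `<=` I ->
  J `&` K = set0 -> events_from J X -> events_from K Y ->
  P (X `&` Y) = (P X * P Y)%E.
Proof.
move=> JI KI JK0 JX KY.
have step Z : finite_intersections K Z -> P (X `&` Z) = (P X * P Z)%E.
  move=> KZ; apply: (independent_of_sigma_algebra _ _ _ JX).2 => //.
  - exact: setI_closed_finite_intersections.
  - exact: measurable_finite_intersection KZ.
  - move=> W JW; split; first exact: measurable_finite_intersection JW.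
    exact: independent_finite_intersections JW KZ.
have mX : measurable X.
  apply: (independent_of_sigma_algebra _ (@measurableT _ Omega) _ JX).1 => //.
  - exact: setI_closed_finite_intersections.
  - move=> W JW; split; first exact: measurable_finite_intersection JW.
    by rewrite setIT probability_setT mule1.
rewrite setIC muleC.
apply: (independent_of_sigma_algebra _ mX _ KY).2 => //.
- exact: setI_closed_finite_intersections.
- move=> W KW; split; first exact: measurable_finite_intersection KW.
  by rewrite setIC muleC step.
Qed.

Lemma measurable_events_from J X : J `<=` I -> events_from J X -> measurable X.
Proof.
move=> JI; apply: smallest_sub; first exact: sigma_algebra_measurable.
by move=> Y; exact: measurable_finite_intersection.
Qed.

Lemma events_from_mono J K : J `<=` K -> events_from J `<=` events_from K.
Proof.
move=> JK; apply: sub_smallest2r; first exact: smallest_sigma_algebra.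
by move=> _ [L LJ ->]; exists L => //; exact: subset_trans LJ JK.
Qed.

Lemma events_from_gen J i : J i -> events_from J (A i).
Proof.
move=> Ji; apply: sub_gen_smallest; exists [fset i]%fset.
  by move=> j /=; rewrite inE => /eqP ->.
by rewrite set_fset1 bigcap_set1.
Qed.

Lemma events_fromT J : events_from J setT.
Proof. exact: (@measurableT _ (g_sigma_algebraType (finite_intersections J))). Qed.

Lemma events_fromC J X : events_from J X -> events_from J (~` X).
Proof. exact: (@measurableC _ (g_sigma_algebraType (finite_intersections J))). Qed.

Lemma events_fromI J X Y :
  events_from J X -> events_from J Y -> events_from J (X `&` Y).
Proof. exact: (@measurableI _ (g_sigma_algebraType (finite_intersections J))). Qed.

Lemma events_fromU J X Y :
  events_from J X -> events_from J Y -> events_from J (X `|` Y).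
Proof. exact: (@measurableU _ (g_sigma_algebraType (finite_intersections J))). Qed.

Lemma events_from0 J : events_from J set0.
Proof. exact: (@measurable0 _ (g_sigma_algebraType (finite_intersections J))). Qed.

(** Independent events of probability at least [q k] all fail with probability
    at most the product of the [1 - q k]. *)
Lemma independent_union_le (K : eqType) (ks : seq K) (J : K -> set T)
    (X : K -> set Omega) (q : K -> R) : uniq ks ->
  {in ks, forall k, J k `<=` I} ->
  {in ks, forall k, events_from (J k) (X k)} ->
  {in ks &, forall k l, k != l -> J k `&` J l = set0} ->
  {in ks, forall k, ((q k)%:E <= P (X k))%E} ->
  (P (~` \big[setU/set0]_(k <- ks) X k) <= (\prod_(k <- ks) (1 - q k))%:E)%E.
Proof.
elim: ks => [|k ks IH] /=.
  by move=> _ _ _ _ _; rewrite !big_nil setC0 probability_setT.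
case/andP=> kks uks JI XJ JJ qX; rewrite !big_cons setCU.
have subks l : l \in ks -> l \in k :: ks by rewrite inE orbC => ->.
have kin : k \in k :: ks by rewrite inE eqxx.
have rest : events_from (\bigcup_(l in [set` ks]) J l)
    (\big[setU/set0]_(l <- ks) X l).
  rewrite big_seq; elim/big_ind: _ => [||l lks]; first exact: events_from0.
  - by move=> ? ?; exact: events_fromU.
  - by apply: events_from_mono (XJ l (subks l lks)); exact: bigcup_sup.
rewrite (@independent_events_from (J k) (\bigcup_(l in [set` ks]) J l)).
- rewrite EFinM; apply: lee_pmul => //.
    rewrite probability_setC ?EFinB ?leeB ?qX //.
    exact: measurable_events_from (JI k kin) (XJ k kin).
  apply: IH => //.
  - by move=> l /subks; exact: JI.
  - by move=> l /subks; exact: XJ.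
  - by move=> l m /subks lk /subks mk; exact: JJ.
  - by move=> l /subks; exact: qX.
- exact: JI.
- by apply: bigcup_sub => l /subks; exact: JI.
- rewrite setI_bigcupr; apply: bigcup0 => l /= lks.
  apply: JJ => //; first exact: subks.
  by apply/eqP => kl; move: kks; rewrite kl lks.
- exact: events_fromC (XJ k kin).
- exact: events_fromC.
Qed.

End Independence.

(** * Measurability of the infinite cluster *)

Section Measurability.

(** Infiniteness as a countable combination of membership conditions, which
    turns it into a measurable condition on a random set. *)
Lemma infinite_range_surj (V : choiceType) (f : nat -> V) (A : set V) :
  (forall v, exists n, f n = v) ->
  infinite_set A <->
  forall N, exists m, A (f m) /\ forall i, (i < N)%N -> f i <> f m.
Proof.
move=> fsurj; split=> [infA N|H finA].
  apply: contrapT => nm; apply: infA.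
  apply: (sub_finite_set (B := f @` `I_N)); last exact/finite_image/finite_II.
  move=> v Av; have [m mv] := fsurj v.
  apply: contrapT => nv; apply: nm; exists m; rewrite mv; split=> // i iN fi.
  by apply: nv; exists i.
have [N fN] : exists N, forall v, A v -> exists2 i, (i < N)%N & f i = v.
  have /finite_seqP[s ->] := finA.
  elim: s => [|v s [N sN]]; first by exists 0%N.
  have [n nv] := fsurj v; exists (maxn N n.+1) => u /=.
  rewrite inE => /orP[/eqP ->|/sN[i iN iu]].
    by exists n => //; rewrite leq_max leqnn orbT.
  by exists i => //; rewrite leq_max iN.
have [m [/fN[i iN fi] /(_ i iN)]] := H N.
by [].
Qed.

Context (V : choiceType) (adj : rel V).
Context (d : measure_display) (Omega : measurableType d).
Variable op : {fset V} -> set Omega.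
Hypothesis mop : forall e, edges adj e -> measurable (op e).

Lemma measurable_open_path u s :
  measurable [set w | path (open_adj adj op w) u s].
Proof.
elim: s u => [|v s IH] u /=.
  by rewrite [X in measurable X](_ : _ = setT) //; apply/seteqP; split.
have [uv|nuv] := boolP (adj u v).
  rewrite [X in measurable X](_ : _ = op [fset u; v]%fset `&`
      [set w | path (open_adj adj op w) v s]).
    by apply: measurableI => //; apply: mop; exists u, v.
  apply/seteqP; split => w /=.
    by move=> /andP[/andP[_ /asboolP]].
  move=> [uvw sw]; apply/andP; split=> //; apply/andP; split=> //.
  exact/asboolP.
rewrite [X in measurable X](_ : _ = set0) //.
by apply/seteqP; split => w //= /andP[/andP[uv _] _]; rewrite uv in nuv.
Qed.

Hypothesis countV : exists f : nat -> V, forall v, exists n, f n = v.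

Lemma measurable_in_infinite_cluster e : edges adj e ->
  measurable (in_infinite_cluster adj op e).
Proof.
move=> he; have [f fsurj] := countV.
pose walk (n : nat) : seq V := map f (odflt [::] (@choice.unpickle (seq nat) n)).
have walkP s : exists n, walk n = s.
  suff [l ls] : exists l, map f l = s.
    by exists (choice.pickle l); rewrite /walk choice.pickleK.
  elim: s => [|v s [l <-]]; first by exists [::].
  by have [n <-] := fsurj v; exists (n :: l).
pose connected v : set Omega := \bigcup_n \bigcup_k
  (if (f n \in e) && (last (f n) (walk k) == v)
   then [set w | path (open_adj adj op w) (f n) (walk k)] else set0).
have connectedE v w : connected v w <-> open_cluster adj op w e v.
  split.
    move=> [n _ [k _]]; case: ifP => // /andP[ne /eqP kv] /= kw.
    by exists (f n), (walk k).
  move=> [u [s [ue us sv]]]; have [n nu] := fsurj u; have [k ks] := walkP s.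
  by exists n => //; exists k => //; rewrite nu ks ue sv eqxx.
have mconnected v : measurable (connected v).
  apply: bigcupT_measurable => n; apply: bigcupT_measurable => k.
  by case: ifP => // _; exact: measurable_open_path.
rewrite [X in measurable X](_ : _ = op e `&` \bigcap_N \bigcup_m
    (if `[< forall i, (i < N)%N -> f i <> f m >] then connected (f m) else set0)).
  apply: measurableI; first exact: mop.
  apply: bigcapT_measurable => N; apply: bigcupT_measurable => m.
  by case: ifP => // _; exact: mconnected.
apply/seteqP; split => w [ew].
  move=> /(infinite_range_surj _ fsurj) H; split=> // N _.
  have [m [wm Nm]] := H N; exists m => //.
  by rewrite (asboolT Nm); exact/connectedE.
move=> H; split=> //; apply/(infinite_range_surj _ fsurj) => N.
have [m _] := H N I; case: asboolP => // Nm /connectedE wm.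
by exists m.
Qed.

End Measurability.

Section Enumeration.
Variables (V : choiceType) (adj : rel V) (rot : V -> V -> V).
Hypothesis sym : symmetric adj.
Hypothesis hconn : connected_graph adj.
Hypothesis hrot : rotation_system adj rot.

(** [rot v] reaches every neighbour of [v], so turns describe all walks. *)
Lemma word_walk_surj d s : adj d.1 d.2 -> path adj d.2 s ->
  exists w, word_walk rot d w = s.
Proof.
elim: s d => [|v s IH] d dd /=; first by exists [::].
case/andP=> dv vs; have d21 : adj d.2 d.1 by rewrite sym.
have [_ /(_ v dv)[k kv]] := hrot d21.
have [|w ws] := IH (turn rot d k) (adj_turn sym hrot k dd).
  by rewrite /= kv.
by exists (k :: w); rewrite /= ws kv.
Qed.

Lemma countable_vertices d : adj d.1 d.2 ->
  exists f : nat -> V, forall v, exists n, f n = v.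
Proof.
pose word (n : nat) := odflt [::] (@choice.unpickle (seq nat) n).
move=> dd; exists (fun n => (follow rot d (word n)).2) => v.
have [s ds sv] := hconn d.2 v; have [w ws] := word_walk_surj dd ds.
by exists (choice.pickle w); rewrite /word choice.pickleK /= -last_word_walk ws.
Qed.

End Enumeration.

(** * Percolation on the tree *)

Section Percolation.
Variables (V : choiceType) (adj : rel V) (rot : V -> V -> V).
Hypothesis sym : symmetric adj.
Hypothesis hreg : regular_graph adj 5.
Hypothesis hrot : rotation_system adj rot.
Hypothesis hface : forall u v, adj u v -> face_has_length rot (u, v) 5.
Hypothesis hsc : simply_connected adj rot.
Variables (d : V * V).
Hypothesis dadj : adj d.1 d.2.
Context (R : realType) (disp : measure_display) (Omega : measurableType disp).
Variables (P : probability Omega R) (op : {fset V} -> set Omega) (p : R).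
Hypothesis p01 : 299 / 1000 <= p <= 1.
Hypothesis hperc : bond_percolation adj p P op.

Local Notation s0 := (true, true).
Local Notation edge := (last_edge rot d).

(** Some word of length [n] accepted from [s] extends [w] by open edges only. *)
Fixpoint reaches (n : nat) (s : state) (w : seq nat) : set Omega :=
  if n is n'.+1 then
    \big[setU/set0]_(k <- turns s)
      (op (edge (rcons w k)) `&` reaches n' (next_state s k) (rcons w k))
  else setT.

Definition edges_below (s : state) (w : seq nat) : set {fset V} :=
  [set e | exists k t, accepted s (k :: t) /\ e = edge (w ++ k :: t)].

Lemma edges_belowS s w k : k \in turns s ->
  edges_below (next_state s k) (rcons w k) `<=` edges_below s w.
Proof.
move=> ks _ [l [t [at_ ->]]]; exists k, (l :: t).
by rewrite cat_rcons; split=> //=; rewrite ks.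
Qed.

Lemma edges_below_edges s w : edges_below s w `<=` edges adj.
Proof. by move=> _ [k [t [_ ->]]]; exact: last_edge_edges. Qed.

Lemma reaches_events n s w : events_from op (edges_below s w) (reaches n s w).
Proof.
elim: n s w => [|n IH] s w /=; first exact: events_fromT.
rewrite big_seq; elim/big_ind: _ => [||k ks]; first exact: events_from0.
  by move=> ? ?; exact: events_fromU.
apply: events_fromI; last first.
  by apply: (events_from_mono (edges_belowS (w := w) ks)); exact: IH.
by apply: events_from_gen; exists k, [::]; rewrite /= ks cats1.
Qed.

(** A small multiple of an approximation of the eigenvector (sqrt 2, 1, 1) of the
    automaton for its eigenvalue 2 + sqrt 2; it has to be small for the
    quadratic terms of the recursion to stay below the gain of the linear
    ones. *)
Definition survival_bound (s : state) : R :=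
  if s.1 && s.2 then 14 / 1000 else 1 / 100.

(** At the vertex of a word in state [s], the walk dies if it dies along each
    turn, which happens with probability at most [1 - p q] when the subtree
    survives with probability at least [q]. *)
Lemma survival_bound_step s : s.1 || s.2 ->
  \prod_(k <- turns s) (1 - p * survival_bound (next_state s k)) <=
  1 - survival_bound s.
Proof.
have /andP[p0 p1] := p01.
case: s => [[] []] // _; rewrite /turns /survival_bound /= !big_cons big_nil mulr1.
all: set a := 1 - p * (1 / 100); set b := 1 - p * (14 / 1000).
all: have [a0 a1] : 0 <= a /\ a <= 1 - 299 / 1000 / 100 by rewrite /a; split; lra.
all: have [b0 b1] : 0 <= b /\ b <= 1 - 299 / 1000 * 14 / 1000
  by rewrite /b; split; lra.
all: clearbody a b; clear p p01 hperc p0 p1.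
all: have ab := ler_pM a0 b0 a1 b1; have ab0 : 0 <= a * b by exact: mulr_ge0.
all: have aab := ler_pM a0 ab0 a1 ab; have abab := ler_pM ab0 ab0 ab ab.
all: lra.
Qed.

Let mop e : edges adj e -> measurable (op e).
Proof. by case: hperc => + _ _; apply. Qed.

Let indop : independent_events P (edges adj) op.
Proof. by case: hperc. Qed.

Lemma measurable_reaches n s w : measurable (reaches n s w).
Proof.
apply: (measurable_events_from mop (edges_below_edges (s := s) (w := w))).
exact: reaches_events.
Qed.

Lemma last_edge_notin_below s w k : accepted s (rcons w k) ->
  ~ edges_below (foldl next_state s (rcons w k)) (rcons w k) (edge (rcons w k)).
Proof.
move=> awk [l [t [alt]]] /(last_edge_inj sym hreg hrot hface hsc R dadj awk).
rewrite accepted_cat awk => /(_ alt) /(congr1 size) /eqP.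
by rewrite size_cat /= -[X in X == _]addn0 eqn_add2l.
Qed.

Lemma survival_bound_ge0 s : 0 <= survival_bound s.
Proof. by rewrite /survival_bound; case: ifP => _; lra. Qed.

(** The edge entering a subtree is independent of the subtree. *)
Lemma reaches_edge_ge n s w k : accepted s (rcons w k) ->
  ((survival_bound (foldl next_state s (rcons w k)))%:E <=
    P (reaches n (foldl next_state s (rcons w k)) (rcons w k)))%E ->
  ((p * survival_bound (foldl next_state s (rcons w k)))%:E <=
    P (op (edge (rcons w k)) `&`
       reaches n (foldl next_state s (rcons w k)) (rcons w k)))%E.
Proof.
move=> awk H; set e := edge (rcons w k).
have ee : edges adj e by exact: last_edge_edges.
rewrite (independent_events_from mop indop (J := [set e])
  (K := edges_below (foldl next_state s (rcons w k)) (rcons w k))).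
- have [_ -> // _] := hperc; rewrite EFinM; apply: lee_pmul => //.
    by rewrite lee_fin; have /andP[] := p01; lra.
  by rewrite lee_fin survival_bound_ge0.
- by move=> _ ->.
- exact: edges_below_edges.
- apply/seteqP; split => // x [/= ->]; exact: last_edge_notin_below.
- exact: events_from_gen.
- exact: reaches_events.
Qed.

Lemma turns_next_state s k : k \in turns s ->
  (next_state s k).1 || (next_state s k).2.
Proof. by case: s k => [[] []] [|[|[|[|[|k]]]]]. Qed.

Lemma uniq_turns s : uniq (turns s).
Proof. by case: s => [[] []]. Qed.

(** Induction on the depth; the subtrees of the turns at the end of [w] have
    disjoint sets of edges because the words of these edges differ. *)
Lemma reaches_ge n w : let s := foldl next_state s0 w in
  accepted s0 w -> s.1 || s.2 ->
  ((survival_bound s)%:E <= P (reaches n s w))%E.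
Proof.
elim: n w => [|n IH] w s aw sw.
  rewrite /= probability_setT lee_fin /survival_bound; case: ifP => _; lra.
have acc k : k \in turns s -> accepted s0 (rcons w k).
  by move=> ks; rewrite -cats1 accepted_cat aw /= ks.
have sk k : foldl next_state s0 (rcons w k) = next_state s k.
  by rewrite foldl_rcons.
pose X k := op (edge (rcons w k)) `&` reaches n (next_state s k) (rcons w k).
pose J k := [set edge (rcons w k)] `|` edges_below (next_state s k) (rcons w k).
have JE k e : J k e -> k \in turns s ->
    exists2 t, accepted s0 (rcons w k ++ t) & e = edge (rcons w k ++ t).
  move=> [->|[l [t [alt ->]]]] ks.
    by exists [::]; rewrite cats0 ?acc.
  by exists (l :: t) => //; rewrite accepted_cat acc // sk.
have XP : (P (~` \big[setU/set0]_(k <- turns s) X k) <=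
    (\prod_(k <- turns s) (1 - p * survival_bound (next_state s k)))%:E)%E.
  apply: (independent_union_le mop indop (J := J)).
  - exact: uniq_turns.
  - move=> k ks e [->|]; [exact: last_edge_edges|exact: edges_below_edges].
  - move=> k ks; apply: events_fromI.
      by apply: events_from_gen; left.
    apply: (events_from_mono (J := edges_below (next_state s k) (rcons w k))).
      by move=> e; right.
    exact: reaches_events.
  - move=> k l ks ls kl; apply/seteqP; split=> // e [].
    move=> /JE/(_ ks)[t at_ ->] /JE/(_ ls)[u au].
    move/(last_edge_inj sym hreg hrot hface hsc R dadj at_ au).
    rewrite !cat_rcons => /eqP; rewrite eqseq_cat // eqxx /= => /eqP[kl' _].
    by rewrite kl' eqxx in kl.
  - move=> k ks; have := @reaches_edge_ge n s0 w k (acc k ks).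
    rewrite sk; apply; rewrite -sk; apply: IH; first exact: acc.
    by rewrite sk turns_next_state.
have mX : measurable (reaches n.+1 s w) by exact: measurable_reaches.
rewrite -[reaches n.+1 s w]setCK probability_setC; last exact: measurableC.
rewrite leeBrDr; last first.
  by apply: fin_num_probability; exact: measurableC.
apply: (@le_trans _ _ ((survival_bound s)%:E +
  (\prod_(k <- turns s) (1 - p * survival_bound (next_state s k)))%:E)%E).
  by apply: leeD.
rewrite -EFinD lee_fin; have := survival_bound_step sw; lra.
Qed.

Lemma reaches_path n s w omega : reaches n s w omega ->
  exists2 t, size t = n /\ accepted s t &
    path (open_adj adj op omega) (follow rot d w).2
      (word_walk rot (follow rot d w) t).
Proof.
elim: n s w => [|n IH] s w /=; first by exists [::].
rewrite big_seq; elim/big_ind: _ => [//|X Y HX HY [/HX//|/HY//]|k ks].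
move=> [opk /IH[t [tn at_] pt]]; exists (k :: t) => /=; first by rewrite tn ks.
rewrite follow_rcons in pt; rewrite pt andbT; apply/andP; split.
  by have := adj_turn sym hrot k (adj_follow sym hrot w dadj).
by apply/asboolP; move: opk; rewrite /last_edge follow_rcons.
Qed.

(** The cluster contains a vertex of the tree at each depth. *)
Lemma infinite_cluster_of_reaches omega e : e = [fset d.1; d.2]%fset ->
  op e omega -> (forall n, reaches n s0 [::] omega) ->
  in_infinite_cluster adj op e omega.
Proof.
move=> eE ope H; split=> //.
have /choice[t tP] n : exists t, (size t = n /\ accepted s0 t) /\
    path (open_adj adj op omega) d.2 (word_walk rot d t).
  by have [t ? ?] := reaches_path (H n); exists t.
pose g n := (follow rot d (t n)).2.
have ginj : {in [set: nat] &, injective g}.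
  move=> i j _ _; have [[si ai] _] := tP i; have [[sj aj] _] := tP j.
  move/(vertex_inj sym hreg hrot hface hsc R dadj ai aj) => tij.
  by rewrite -si -sj tij.
apply: (@sub_infinite_set _ (g @` setT)).
  move=> _ [n _ <-]; exists d.2, (word_walk rot d (t n)).
  have [_ pt] := tP n; split=> //; last exact: last_word_walk.
  by rewrite eE !inE eqxx orbT.
apply/infiniteP; have := inj_card_eq ginj.
by rewrite card_eqPle => -[].
Qed.

Lemma nonincreasing_reaches s w : nonincreasing_seq (fun n => reaches n s w).
Proof.
apply/nonincreasing_seqP => n; apply/subsetPset.
elim: n s w => [//|n IH] s w.
rewrite [reaches n.+2 s w]/= [reaches n.+1 s w]/=.
elim: (turns s) => [|k ks IHks]; first by rewrite !big_nil.
by rewrite !big_cons; apply: setUSS => //; apply: setIS; exact: IH.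
Qed.

(** Continuity from above along the decreasing events that depth [n] is
    reached. *)
Lemma infinite_cluster_gt0 e : e = [fset d.1; d.2]%fset ->
  measurable (in_infinite_cluster adj op e) ->
  (0 < P (in_infinite_cluster adj op e))%E.
Proof.
move=> eE mC.
have ee : edges adj e by exists d.1, d.2.
pose F n := op e `&` reaches n s0 [::].
have mF n : measurable (F n).
  by apply: measurableI; [exact: mop|exact: measurable_reaches].
have FC : \bigcap_n F n `<=` in_infinite_cluster adj op e.
  move=> w Fw; apply: infinite_cluster_of_reaches => //.
    by have [] := Fw 0%N I.
  by move=> n; have [] := Fw n I.
have mI : measurable (\bigcap_n F n) by exact: bigcapT_measurable.
have Fge n : ((299 / 1000 * (14 / 1000))%:E <= P (F n))%E.
  rewrite /F (independent_events_from mop indop (J := [set e])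
    (K := edges_below s0 [::])).
  - have [_ /(_ e ee) Pe _] := hperc; rewrite Pe EFinM; apply: lee_pmul.
    + by rewrite lee_fin; lra.
    + by rewrite lee_fin; lra.
    + by rewrite lee_fin; have /andP[] := p01.
    + exact: (@reaches_ge n [::]).
  - by move=> _ ->.
  - exact: edges_below_edges.
  - apply/seteqP; split => // x [/= ->] [k [t [akt]]].
    rewrite eE => eqe.
    by have := last_edge_inj sym hreg hrot hface hsc R dadj
      (isT : accepted s0 [::]) akt eqe.
  - exact: events_from_gen.
  - exact: reaches_events.
have cv : P \o F @ \oo --> P (\bigcap_n F n).
  apply: nonincreasing_cvg_mu => //.
    by rewrite ltey_eq fin_num_probability.
  move=> i j ij; apply/subsetPset; apply: setIS; apply/subsetPset.
  exact: nonincreasing_reaches.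
apply: (@lt_le_trans _ _ (299 / 1000 * (14 / 1000))%:E).
  by rewrite lte_fin; lra.
apply: (@le_trans _ _ (P (\bigcap_n F n))); last first.
  by apply: le_measure => //; rewrite inE.
rewrite -(cvg_lim _ cv) //; apply: lime_ge; first by apply/cvg_ex; eexists; exact: cv.
by near=> n; exact: Fge.
Unshelve. all: by end_near.
Qed.

End Percolation.

(** * The critical probability *)

Lemma bound_ge (R : realType) : (299 / 1000 : R) <= 299973%:R / 10 ^+ 6.
Proof.
(* The comparison is done in nat, on closed numerals. *)
have h : (299%:R * 1000%:R : R) <= 299973%:R.
  by rewrite -natrM ler_nat; vm_compute.
by move: h; set x := 299973%:R; clearbody x; lra.
Qed.

Theorem mainTheorem6 (R : realType) (V : choiceType) (adj : rel V)
    (d : measure_display) (Omega : measurableType d)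
    (P : R -> probability Omega R) (op : R -> {fset V} -> set Omega)
    (e : {fset V})
    (hG : regular_plane_tiling 5 adj)
    (hperc : forall p : R, 0 <= p <= 1 -> bond_percolation adj p (P p) (op p))
    (he : edges adj e) :
  critical_probability adj P op e <= 299973%:R / 10 ^+ 6.
Proof.
have [[sym _ _ hconn hreg] [rot [hrot hface hsc]]] := hG.
have [u [v [uv eE]]] := he.
have b0 := bound_ge R.
rewrite /critical_probability; set S := [set p : R | _].
have [->|S0] := eqVneq S set0; first by rewrite sup0; apply: le_trans b0; lra.
apply: ge_sup; first exact/set0P.
move=> p [/= /[dup] p01 /andP[_ p1] Pp0]; rewrite leNgt; apply/negP => bp.
have hp := hperc p p01.
have p01' : 299 / 1000 <= p <= 1 by rewrite p1 andbT (le_trans b0) // ltW.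
have mop e' : edges adj e' -> measurable (op p e') by case: hp => + _ _; apply.
have mC := measurable_in_infinite_cluster mop
  (countable_vertices (d := (u, v)) sym hconn hrot uv) he.
have := infinite_cluster_gt0 sym hreg hrot hface hsc (d := (u, v)) uv p01' hp eE mC.
by rewrite Pp0 ltxx.
Qed.
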